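(* Algorithm 2 is a factor-$1.5$ approximation algorithm for $1|(p_j,L,p_j)|\sum C_j$. That is, Algorithm 2 runs in polynomial time, and for every instance with $a_j=b_j=p_j$ and $L_j=L$ for all jobs $j$, it outputs a feasible schedule whose sum of completion times is at most $1.5$ times the minimum sum of completion times over all feasible schedules.
   Context: Coupled task scheduling on a single machine: each job $j\in\{1,\dots,n\}$ has a first task of processing time $a_j>0$, a second task of processing time $b_j>0$, and a delay time $L_j\ge 0$. The two tasks of job $j$ are also denoted $a_j$ and $b_j$. A feasible schedule assigns a starting time $S_j\ge 0$ to each job $j$; the first task occupies $[S_j,S_j+a_j]$, the second task occupies $[S_j+a_j+L_j,\,S_j+a_j+L_j+b_j]$ (the delay is exact, no preemption), and no two of the $2n$ tasks overlap (their intervals have disjoint interiors). Other tasks may be processed during the delay of a job. The completion time of $j$ is $C_j=S_j+a_j+L_j+b_j$, and the objective is to minimize $\sum_{j=1}^n C_j$. Algorithm 2. Input: an instance with $L_j=L$ for all $j$. Step 1: sort the jobs in non-decreasing order of $a_j+b_j$ and re-index them in this order. Step 2: schedule $a_1$ from time $0$ and $b_1$ from time $a_1+L$. Let $s:=1$, $j_s:=1$. Step 3: for $j=2,\dots,n$: (i) if it is possible to start $a_j$ immediately after $a_{j-1}$ (at the completion of $a_{j-1}$) with neither $a_j$ nor $b_j$ intersecting any task already scheduled, then do so and go to the next job; (ii) otherwise, if it is possible to start $b_j$ right after $b_{j-1}$ (at the completion of $b_{j-1}$) with neither $a_j$ nor $b_j$ intersecting any task already scheduled, then do so and go to the next job;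 (iii) otherwise start $a_j$ immediately after $b_{j-1}$, and let $s:=s+1$, $j_s:=j$. In all cases the other task of $j$ is placed according to the exact delay $L$. *)

(* Defs.v *)
From HB Require Import structures.
From mathcomp Require Import all_boot all_order all_algebra.

Set Implicit Arguments.
Unset Strict Implicit.
Unset Printing Implicit Defensive.

Import Order.TTheory GRing.Theory Num.Theory.
Local Open Scope ring_scope.

Section Scheduling.

Variables (R : realFieldType) (n : nat).
Variables (a L b S : 'I_n -> R).

(* A task is a pair (j, second): [(j, false)] is the first task of job j and  *)
(* [(j, true)] its second task.                                               *)
Definition task_start (t : 'I_n * bool) : R :=
  if t.2 then S t.1 + a t.1 + L t.1 else S t.1.

Definition task_end (t : 'I_n * bool) : R :=
  task_start t + (if t.2 then b t.1 else a t.1).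

Definition feasible : Prop :=
  (forall j, 0 <= S j) /\
  (forall t u : 'I_n * bool, t != u ->
     forall x : R, x \in `]task_start t, task_end t[ ->
                   x \notin `]task_start u, task_end u[).

Definition completion (j : 'I_n) : R := S j + a j + L j + b j.

Definition sum_completion : R := \sum_(j < n) completion j.

End Scheduling.

(* Programs over an abstract type T of numbers, as trees of elementary steps. *)
(* As T is abstract, a program can only compute with, or compare, numbers     *)
(* through these (charged) operations; [Tick] is charged for every step of a  *)
(* traversal of a list.                                                       *)
Inductive prog (T A : Type) : Type :=
| Ret of A
| Tick of prog T A
| Zero of (T -> prog T A)
| Add of T & T & (T -> prog T A)
| Sub of T & T & (T -> prog T A)
| Leq of T & T & (bool -> prog T A).

Arguments Ret {T A} _.
Arguments Tick {T A} _.
Arguments Zero {T A} _.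
Arguments Add {T A} _ _ _.
Arguments Sub {T A} _ _ _.
Arguments Leq {T A} _ _ _.

Fixpoint bind (T A B : Type) (e : prog T A) (f : A -> prog T B) : prog T B :=
  match e with
  | Ret x => f x
  | Tick k => Tick (bind k f)
  | Zero k => Zero (fun z => bind (k z) f)
  | Add x y k => Add x y (fun z => bind (k z) f)
  | Sub x y k => Sub x y (fun z => bind (k z) f)
  | Leq x y k => Leq x y (fun c => bind (k c) f)
  end.

Notation "'let!' x := e 'in' f" := (bind e (fun x => f))
  (at level 200, x name, e at level 200, f at level 200).

Section Semantics.

Variables (R : realFieldType) (A : Type).

Fixpoint run (e : prog R A) : A :=
  match e with
  | Ret x => x
  | Tick k => run k
  | Zero k => run (k 0)
  | Add x y k => run (k (x + y))
  | Sub x y k => run (k (x - y))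
  | Leq x y k => run (k (x <= y))
  end.

(* [w x y] is the price of a binary operation on the operands x and y.        *)
Fixpoint cost (w : R -> R -> nat) (e : prog R A) : nat :=
  match e with
  | Ret _ => 0
  | Tick k => 1 + cost w k
  | Zero k => 1 + cost w (k 0%R)
  | Add x y k => w x y + cost w (k (x + y)%R)
  | Sub x y k => w x y + cost w (k (x - y)%R)
  | Leq x y k => w x y + cost w (k (x <= y)%R)
  end%N.

End Semantics.

Section Algorithm2.

Variables (I T : Type).

Record job := Job { job_id : I; len1 : T; len2 : T }.

(* A job with the two intervals [start1, end1], [start2, end2] of its tasks.  *)
Record placed := Placed
  { placed_id : I; start1 : T; end1 : T; start2 : T; end2 : T }.

Definition add (x y : T) : prog T T := Add x y Ret.
Definition sub (x y : T) : prog T T := Sub x y Ret.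
Definition leq_num (x y : T) : prog T bool := Leq x y Ret.

Fixpoint insert (k : T) (j : job) (l : seq (T * job)) : prog T (seq (T * job)) :=
  Tick (match l with
  | [::] => Ret [:: (k, j)]
  | (k', j') :: l' =>
      let! c := leq_num k k' in
      if c then Ret ((k, j) :: l)
      else let! r := insert k j l' in Ret ((k', j') :: r)
  end).

Fixpoint sort_jobs (l : seq job) : prog T (seq (T * job)) :=
  Tick (match l with
  | [::] => Ret [::]
  | j :: l' =>
      let! r := sort_jobs l' in
      let! k := add (len1 j) (len2 j) in
      insert k j r
  end).

Variable L : T.

Definition place_first_at (j : job) (s : T) : prog T placed :=
  let! e := add s (len1 j) in
  let! s' := add e L in
  let! e' := add s' (len2 j) in
  Ret (Placed (job_id j) s e s' e').

Definition place_second_at (j : job) (s' : T) : prog T placed :=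
  let! e := sub s' L in
  let! s := sub e (len1 j) in
  let! e' := add s' (len2 j) in
  Ret (Placed (job_id j) s e s' e').

(* For nondegenerate intervals: the interiors of [s, e] and [s', e'] are      *)
(* disjoint.                                                                  *)
Definition apart (s e s' e' : T) : prog T bool :=
  let! c := leq_num e s' in
  if c then Ret true else leq_num e' s.

Fixpoint slot_free (s e : T) (sched : seq placed) : prog T bool :=
  Tick (match sched with
  | [::] => Ret true
  | q :: sched' =>
      let! c1 := apart s e (start1 q) (end1 q) in
      if c1 then
        let! c2 := apart s e (start2 q) (end2 q) in
        if c2 then slot_free s e sched' else Ret false
      else Ret false
  end).

Definition fits (q : placed) (sched : seq placed) : prog T bool :=
  let! c := slot_free (start1 q) (end1 q) sched in
  if c then slot_free (start2 q) (end2 q) sched else Ret false.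

(* [prev] is the job placed last and [older] the jobs placed before it. The   *)
(* block counter s and the block heads j_s do not influence the schedule and  *)
(* are left out.                                                              *)
Fixpoint place_all (prev : placed) (older : seq placed) (l : seq (T * job)) :
    prog T (seq placed) :=
  Tick (match l with
  | [::] => Ret (prev :: older)
  | (_, j) :: l' =>
      let! q1 := place_first_at j (end1 prev) in
      let! c1 := fits q1 (prev :: older) in
      if c1 then place_all q1 (prev :: older) l' else
      let! q2 := place_second_at j (end2 prev) in
      let! c2 := fits q2 (prev :: older) in
      if c2 then place_all q2 (prev :: older) l' else
      let! q3 := place_first_at j (end2 prev) in
      place_all q3 (prev :: older) l'
  end).

Definition algorithm2 (jobs : seq job) : prog T (seq placed) :=
  let! l := sort_jobs jobs in
  match l with
  | [::] => Ret [::]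
  | (_, j) :: l' =>
      let! z := Zero Ret in
      let! q := place_first_at j z in
      place_all q [::] l'
  end.

End Algorithm2.

Definition jobs_of (T : Type) (n : nat) (a b : 'I_n -> T) : seq (job 'I_n T) :=
  [seq Job j (a j) (b j) | j <- enum 'I_n].

Definition algorithm2_schedule (R : realFieldType) (n : nat)
    (a b : 'I_n -> R) (L : R) (j : 'I_n) : R :=
  let out := run (algorithm2 L (jobs_of a b)) in
  nth 0 [seq start1 q | q <- out] (index j [seq placed_id q | q <- out]).

Definition bitlen (m : nat) : nat := (trunc_log 2 m).+1.

Definition rat_size (x : rat) : nat :=
  (1 + bitlen `|numq x| + bitlen `|denq x|)%N.

(* Quadratic in the operand length, as for schoolbook arithmetic, including   *)
(* the reduction of a fraction by the Euclidean algorithm.                    *)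
Definition bit_cost (x y : rat) : nat :=
  ((rat_size x + rat_size y) ^ 2)%N.

Definition instance_size (n : nat) (a b : 'I_n -> rat) (L : rat) : nat :=
  (\sum_(j < n) (rat_size (a j) + rat_size (b j)) + rat_size L)%N.

(* Main.v *)
Require Import Defs.
From HB Require Import structures.
From mathcomp Require Import all_boot all_order all_algebra.
From mathcomp Require Import ring lra zify.

Set Implicit Arguments.
Unset Strict Implicit.
Unset Printing Implicit Defensive.

Import Order.TTheory GRing.Theory Num.Theory.
Local Open Scope ring_scope.

(* Step (ii) never succeeds when step (i) fails, so the jobs form blocks whose *)
(* first tasks are contiguous. In an arbitrary feasible schedule, the job that *)
(* completes in position k does so after the first tasks of k jobs, the delay  *)
(* and its own second task, and also after the total load of k jobs, where a   *)
(* job longer than L has load 2p + L because no task can use its delay, and    *)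
(* another job has load 2p. Prefix sums are least in the sorted order.         *)
(* Compared with 3/2 of these bounds, every job of the algorithm up to length  *)
(* L is paid for, except the first jobs of the second and third blocks, which  *)
(* lack at most L/4 and L/2; the first two jobs leave a surplus of at least L. *)
(* If instead the second job is longer than L, or once a longer job is met,    *)
(* the end of the schedule stays below 3/2 of the load plus L, and the delay   *)
(* that the load counts pays for each further job.                             *)
(* For the running time, every number is a multiple of 1/D, D the product of   *)
(* all denominators, and gains at most three bits per placed job.              *)

(** * The greedy schedule against the lower bound *)

(** Everything is reduced to two recursions over the non-decreasing list of lengths. [run_place_all]
    evaluates the sum of completion times of the algorithm as a [greedy_sum], [sum_completion_ge]
    bounds every feasible schedule below by [lower_sum], and [greedy_sum_le] compares the two.

    The comparison is amortized. Once the total length of the jobs reaches [L], the lower bound on a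
    completion time is twice that length, so 3/2 of it grows three times as fast as the length.
    Inside a block the greedy completion times grow more slowly; opening a block costs about [L],
    but it happens only when the next job no longer fits between the first tasks and the first
    second task of the block, so the block is nearly full. This closes the induction in
    [greedy_sum_late]. The first two jobs pay for the deficits of the second and third blocks, and
    [greedy_sum_long] handles the jobs longer than [L], each of which is alone in its block.

    The lower bound rests on [separate_or_interleaved]: two jobs that overlap in time both have
    length at most [L] and complete in the order in which they start. Task intervals, extended by
    the delay for long jobs, can therefore be packed into a time window.

    The running time is a count of elementary steps times a uniform price, with a common denominator
    keeping all numbers short ([takes_algorithm2]). *)

Section Ratio.

Variables (R : realFieldType) (L : R).
Hypothesis L_ge0 : 0 <= L.

(* [e] and [y] are the end of the first task and the length of the last placed *)
(* job, [beta] is the start of the second task of the first job of the block.  *)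
Fixpoint greedy_sum (e beta y : R) (l : seq R) : R :=
  if l is p :: l' then
    if e + p <= beta then (e + p + L + p) + greedy_sum (e + p) beta p l'
    else let t := e + L + y in
         (t + p + L + p) + greedy_sum (t + p) (t + p + L) p l'
  else 0.

Definition load (p : R) : R := p + p + (if p <= L then 0 else L).

(* [Q] and [W] are the total length and the total load of the previous jobs. *)
Fixpoint lower_sum (Q W : R) (l : seq R) : R :=
  if l is p :: l' then
    (if p <= L then Q + p + p + Num.max Q L else W + load p)
      + lower_sum (Q + p) (W + load p) l'
  else 0.

Lemma greedy_sum_cons e beta y p l : greedy_sum e beta y (p :: l) =
  if e + p <= beta then (e + p + L + p) + greedy_sum (e + p) beta p l
  else (e + L + y + p + L + p)
         + greedy_sum (e + L + y + p) (e + L + y + p + L) p l.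
Proof. by []. Qed.

Lemma lower_sum_cons Q W p l : lower_sum Q W (p :: l) =
  (if p <= L then Q + p + p + Num.max Q L else W + load p)
    + lower_sum (Q + p) (W + load p) l.
Proof. by []. Qed.

(** Here [e + L + y] is the end of the schedule, allowed to exceed 3/2 of the load by [L]. A job
    longer than [L] prolongs the schedule by [2 * p + L], while 3/2 of its load is
    [3 * p + 3 / 2 * L]; the difference exceeds [L] and absorbs the excess. *)
Lemma greedy_sum_long e beta y Q W p l :
  path <=%R y (p :: l) -> L < p ->
  beta <= e + L -> e + L + y <= 3 / 2 * W + L ->
  greedy_sum e beta y (p :: l) <= 3 / 2 * lower_sum Q W (p :: l).
Proof.
have L0 := L_ge0.
elim: l e beta y Q W p => [|q l IH] e beta y Q W p pl Lp Hb HE;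
  (have nofit : beta < e + p by lra);
  rewrite greedy_sum_cons lower_sum_cons /load (lt_geF Lp) (lt_geF nofit).
  by rewrite /=; lra.
have /andP[_ pl'] : (y <= p) && path <=%R p (q :: l) := pl.
have Lq : L < q by case/andP: pl' => pq _; lra.
have H2 : e + L + y + p + L + p <= 3 / 2 * (W + (p + p + L)) + L by lra.
have := IH _ _ p (Q + p) _ q pl' Lq (lexx _) H2.
lra.
Qed.

(* Third and later blocks: [G] is the total length up to the first job of the  *)
(* block, [H] the end of its first task, [r] the length of the other jobs.     *)
Lemma greedy_sum_late G H r e beta y Q W l :
  0 < y -> y <= L -> L <= G -> L <= 3 * G - H -> 0 <= r -> r = 0 \/ y <= r ->
  e = H + r -> beta = H + L -> Q = G + r -> W = Q + Q -> path <=%R y l ->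
  greedy_sum e beta y l <= 3 / 2 * lower_sum Q W l.
Proof.
have L0 := L_ge0.
elim: l G H r e beta y Q W => [|p l IH] G H r e beta y Q W.
  by move=> *; rewrite mulr0.
move=> y0 yL LG HG r0 hr He Hb HQ HW pl.
have [pL|Lp] := lerP p L; last by apply: greedy_sum_long => //; lra.
have /andP[yp pl'] : (y <= p) && path <=%R p l := pl.
have p0 : 0 < p by lra.
rewrite greedy_sum_cons lower_sum_cons /load pL (max_idPl _); last by lra.
have [fit|nofit] := lerP (e + p) beta.
  have := IH G H (r + p) (e + p) beta p (Q + p) (W + (p + p + 0)).
  have pr : p <= r + p by lra.
  move=> /(_ p0 pL LG HG ltac:(lra) (or_intror pr)).
  by move=> /(_ ltac:(lra) ltac:(lra) ltac:(lra) ltac:(lra) pl'); lra.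
(* A job of length at most [L] always fits behind the head of a block, so the failure shows that the
   block has a second job. Then [y <= r] and [L < r + p] pay for the job that opens the new block,
   and [L < r + p] with [y <= L] restores [L <= 3 * G - H]. *)
have yr : y <= r by case: hr => // r00; lra.
have := IH (Q + p) (e + L + y + p) 0 (e + L + y + p) (e + L + y + p + L) p
  (Q + p) (W + (p + p + 0)).
move=> /(_ p0 pL ltac:(lra) ltac:(lra) (lexx _) (or_introl erefl)).
move=> /(_ ltac:(lra) ltac:(lra) ltac:(lra) ltac:(lra) pl'); lra.
Qed.

(* [L / 2] pays for the first job of the third block. *)
Lemma greedy_sum_second G y1 r e beta y Q W l :
  0 < y1 -> y1 <= y -> y <= L -> y1 + y <= G + r -> L <= G -> y1 + y1 <= G ->
  0 <= r -> r = 0 \/ y <= r ->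
  e = G + L + y1 + r -> beta = G + L + y1 + L -> Q = G + r -> W = Q + Q ->
  path <=%R y l ->
  greedy_sum e beta y l <= 3 / 2 * lower_sum Q W l + L / 2.
Proof.
have L0 := L_ge0.
elim: l r e beta y Q W => [|p l IH] r e beta y Q W.
  by move=> *; rewrite /= mulr0; lra.
move=> y10 y1y yL yG LG yyG r0 hr He Hb HQ HW pl.
have [pL|Lp] := lerP p L; last first.
  by have := @greedy_sum_long e beta y Q W p l pl Lp ltac:(lra) ltac:(lra); lra.
have /andP[yp pl'] : (y <= p) && path <=%R p l := pl.
have p0 : 0 < p by lra.
rewrite greedy_sum_cons lower_sum_cons /load pL (max_idPl _); last by lra.
have [fit|nofit] := lerP (e + p) beta.
  have := IH (r + p) (e + p) beta p (Q + p) (W + (p + p + 0)).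
  have pr : p <= r + p by lra.
  move=> /(_ y10 ltac:(lra) pL ltac:(lra) LG yyG ltac:(lra) (or_intror pr)).
  by move=> /(_ ltac:(lra) ltac:(lra) ltac:(lra) ltac:(lra) pl'); lra.
have yr : y <= r by case: hr => // r00; lra.
(* The new job lacks [3 * L + y1 + y - 2 * G - 2 * r - p]. By [L < r + p] and [y <= r] this is below
   [2 * L + y1 - 2 * G], which is at most [L / 2] since [G] is at least [L] and [2 * y1]. *)
have := @greedy_sum_late (Q + p) (e + L + y + p) 0 (e + L + y + p)
  (e + L + y + p + L) p (Q + p) (W + (p + p + 0)) l.
move=> /(_ p0 pL ltac:(lra) ltac:(lra) (lexx _) (or_introl erefl)).
by move=> /(_ ltac:(lra) ltac:(lra) ltac:(lra) ltac:(lra) pl'); lra.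
Qed.

(* First block, at least two jobs: [L / 4] more pays for the first job of the *)
(* second block. *)
Lemma greedy_sum_first x e beta y Q W l :
  0 < x -> x <= y -> y <= L -> x + y <= Q -> e = Q -> beta = x + L ->
  W = Q + Q -> path <=%R y l ->
  greedy_sum e beta y l <= 3 / 2 * lower_sum Q W l + 3 / 4 * L.
Proof.
have L0 := L_ge0.
elim: l e y Q W => [|p l IH] e y Q W.
  by move=> *; rewrite /= mulr0; lra.
move=> x0 xy yL xyQ He Hb HW pl.
have [pL|Lp] := lerP p L; last first.
  by have := @greedy_sum_long e beta y Q W p l pl Lp ltac:(lra) ltac:(lra); lra.
have /andP[yp pl'] : (y <= p) && path <=%R p l := pl.
have p0 : 0 < p by lra.
have mL : L <= Num.max Q L by rewrite le_max lexx orbT.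
have mQ : Q <= Num.max Q L by rewrite le_max lexx.
rewrite greedy_sum_cons lower_sum_cons /load pL; have [fit|nofit] := lerP (e + p) beta.
  have := IH (e + p) p (Q + p) (W + (p + p + 0)).
  by move=> /(_ x0 ltac:(lra) pL ltac:(lra) ltac:(lra) Hb ltac:(lra) pl'); lra.
(* The new job lacks [2 * L + y - p - Q / 2 - 3 / 2 * Num.max Q L]. This is at most [L / 4]: use
   [y <= p] if [Q] is at least [L / 2], and [x + L < Q + p] with [y <= Q] otherwise. The extreme
   case is [x] near 0 and [Q], [y], [p] near [L / 2]. *)
have := @greedy_sum_second (Q + p) y 0 (e + L + y + p) (e + L + y + p + L)
  p (Q + p) (W + (p + p + 0)) l.
move=> /(_ ltac:(lra) yp pL ltac:(lra) ltac:(lra) ltac:(lra) (lexx _)).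
move=> /(_ (or_introl erefl) ltac:(lra) ltac:(lra) ltac:(lra) ltac:(lra) pl').
lra.
Qed.

(** If the first two jobs have lengths [p] and [q] up to [L], they meet their lower bounds
    [2 * p + L] and [p + 2 * q + L] exactly. Half of these bounds is a surplus of at least [L], more
    than the [3 / 4 * L] that the remaining jobs need. If the second job is longer than [L],
    [greedy_sum_long] applies right after the first one. *)
Lemma greedy_sum_le p l : 0 < p -> path <=%R p l ->
  (p + L + p) + greedy_sum p (p + L) p l <= 3 / 2 * lower_sum 0 0 (p :: l).
Proof.
have L0 := L_ge0.
move=> p0 pl; have mL := max_idPr L0.
case: l pl => [|q l] pl.
  by rewrite /= /load mL; case: (lerP p L) => ?; lra.
have /andP[pq ql] : (p <= q) && path <=%R q l := pl.
have [qL|Lq] := lerP q L; last first.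
  have := @greedy_sum_long p (p + L) p (0 + p) (0 + load p) q l pl Lq (lexx _).
  rewrite (lower_sum_cons 0 0) mL; have := erefl (load p).
  by rewrite {2}/load; case: (lerP p L) => ? ? H; have := H ltac:(lra); lra.
have pL : p <= L by lra.
have mL' : L <= Num.max (0 + p) L by rewrite le_max lexx orbT.
have fit : p + q <= p + L by lra.
rewrite greedy_sum_cons !lower_sum_cons /load pL qL fit mL.
have := @greedy_sum_first p (p + q) (p + L) q (0 + p + q)
  (0 + (p + p + 0) + (q + q + 0)) l.
move=> /(_ p0 pq qL ltac:(lra) ltac:(lra) erefl ltac:(lra) ql); lra.
Qed.

End Ratio.

(** * Lower bound for feasible schedules *)

(** Otherwise the midpoint between the larger left end and the smaller right end lies in both
    intervals. *)
Lemma disjoint_itv_apart (R : realFieldType) (x y x' y' : R) :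
  x < y -> x' < y' -> (forall z, z \in `]x, y[ -> z \notin `]x', y'[) ->
  y <= x' \/ y' <= x.
Proof.
move=> xy xy' H; have [|lt1] := lerP y x'; first by left.
have [|lt2] := lerP y' x; first by right.
have [u [ux ux' uxx]] : exists u, [/\ x <= u, x' <= u & u = x \/ u = x'].
  by have [?|?] := lerP x x'; [exists x' | exists x]; split; auto; lra.
have [v [vy vy' vyy]] : exists v, [/\ v <= y, v <= y' & v = y \/ v = y'].
  by have [?|?] := lerP y y'; [exists y | exists y']; split; auto; lra.
have uv : u < v by case: uxx => ->; case: vyy => ->.
have := H ((u + v) / 2); rewrite !in_itv /=.
have -> : x < (u + v) / 2 < y by apply/andP; split; lra.
have -> // : x' < (u + v) / 2 < y' by apply/andP; split; lra.
by move=> /(_ isT).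
Qed.

Lemma packing (R : realFieldType) (T : eqType) (lo hi : T -> R) (s : seq T)
    (x y : R) :
  uniq s -> x <= y -> {in s, forall t, [/\ x <= lo t, lo t <= hi t & hi t <= y]} ->
  {in s &, forall t u, t != u -> hi t <= lo u \/ hi u <= lo t} ->
  \sum_(t <- s) (hi t - lo t) <= y - x.
Proof.
have [m] := ubnP (size s); elim: m s x y => // m IH [|t s] x y /=.
  by move=> *; rewrite big_nil; lra.
rewrite ltnS => sm /andP[ts us] xy sxy dis.
have [xt tt ty] := sxy t (mem_head _ _).
(* The interval [t] cuts the window in two; the induction hypothesis bounds the intervals on either
   side of it. *)
rewrite big_cons (bigID (fun u => hi u <= lo t)) /= -big_filter -[X in _ + (_ + X)]big_filter.
have sub P : {subset filter P s <= s} by move=> u; rewrite mem_filter => /andP[].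
have sub' P u : u \in filter P s -> u \in t :: s.
  by move=> /sub us'; rewrite inE us' orbT.
have szf P : (size (filter P s) < m)%N.
  by apply: leq_ltn_trans sm; rewrite size_filter count_size.
have dis' P : {in filter P s &, forall t u, t != u -> hi t <= lo u \/ hi u <= lo t}.
  by move=> u v /sub' us' /sub' vs'; apply: dis.
have := IH _ x (lo t) (szf (fun u => hi u <= lo t)) (filter_uniq _ us) xt _ (dis' _).
have := IH _ (hi t) y (szf (fun u => ~~ (hi u <= lo t))) (filter_uniq _ us) ty _ (dis' _).
move=> H1 H2.
have {}H2 := H2 _; have {}H1 := H1 _.
have : {in [seq u <- s | hi u <= lo t],
    forall t0 : T, [/\ x <= lo t0, lo t0 <= hi t0 & hi t0 <= lo t]}.
  move=> u uf; have [? ? ?] := sxy u (sub' _ _ uf).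
  by split => //; move: uf; rewrite mem_filter => /andP[].
move=> /H2 {}H2.
have : {in [seq u <- s | ~~ (hi u <= lo t)],
    forall t0 : T, [/\ hi t <= lo t0, lo t0 <= hi t0 & hi t0 <= y]}.
  move=> u uf; have [? ? ?] := sxy u (sub' _ _ uf).
  split => //; move: (uf); rewrite mem_filter => /andP[nle us'].
  have ut : u != t by apply: contraNneq ts => <-.
  by have [le|//] := dis u t (sub' _ _ uf) (mem_head _ _) ut; rewrite le in nle.
move=> /H1; lra.
Qed.

(** * Sorting minimizes prefix sums *)

Section PrefixSums.

Variable R : realFieldType.
Implicit Types s : seq R.

(* Compare each entry with the k-th smallest one, [x]. *)
Lemma sum_take_sorted s s' k : perm_eq s s' -> sorted <=%R s' ->
  \sum_(x <- take k s') x <= \sum_(x <- take k s) x.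
Proof.
move=> ss' so; have szE := perm_size ss'.
have [ks|ks] := leqP (size s') k.
  rewrite !take_oversize ?szE // le_eqVlt; apply/orP; left; apply/eqP.
  by apply: perm_big; rewrite perm_sym.
set x := nth 0 s' k.
have E (t : seq R) : (k < size t)%N ->
    \sum_(z <- take k t) z = \sum_(z <- take k t) (z - x) + x *+ k.
  move=> kt; rewrite big_split /= sumrN big_const_seq count_predT size_take kt.
  by rewrite iter_addr_0 subrK.
rewrite !E ?szE // lerD2r.
(* In sorted order the negative part of [z - x] lives on the first [k] entries. The right-hand side
   is invariant under permutation and bounds the sum of any [k] differences from below. *)
have minE : \sum_(z <- take k s') (z - x) = \sum_(z <- s') Num.min (z - x) 0.
  rewrite -{2}(cat_take_drop k s') big_cat /= [X in _ + X]big1_seq ?addr0.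
    apply: eq_big_seq => z /(nthP 0)[i]; rewrite size_take ks => ik <-.
    rewrite nth_take // (min_idPl _) // subr_le0.
    by apply: (sorted_leq_nth le_trans le_refl) => //; rewrite ?inE ?(ltn_trans ik) // ltnW.
  move=> z /andP[_ /(nthP 0)[i]]; rewrite size_drop => ik <-.
  rewrite nth_drop (min_idPr _) // subr_ge0.
  apply: (sorted_leq_nth le_trans le_refl) => //; rewrite ?inE ?leq_addr //.
  by rewrite -ltn_subRL.
rewrite minE -(perm_big _ ss') /= -{1}(cat_take_drop k s) big_cat /=.
rewrite -[leRHS]addr0 lerD //.
  by apply: ler_sum => z _; rewrite ge_min lexx.
by rewrite -oppr_ge0 -sumrN; apply: sumr_ge0 => z _; rewrite oppr_ge0 ge_min lexx orbT.
Qed.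

End PrefixSums.

(** * From bounds per position to the bound on the total *)

Section LowerBound.

Variables (R : realFieldType) (L : R).
Hypothesis L_ge0 : 0 <= L.

Lemma lower_sumE Q W l : lower_sum L Q W l =
  \sum_(0 <= k < size l)
     (if l`_k <= L
      then let T := Q + \sum_(x <- take k l) x in T + l`_k + l`_k + Num.max T L
      else W + \sum_(x <- take k.+1 l) load L x).
Proof.
elim: l Q W => [|p l IH] Q W; first by rewrite big_geq.
rewrite lower_sum_cons IH /= big_nat_recl //= take0 big_cons !big_nil !addr0.
congr (_ + _); apply: eq_big_nat => k _.
by rewrite !big_cons !addrA.
Qed.

Lemma load_homo : {homo load L : x y / x <= y}.
Proof.
move=> x y xy; rewrite /load; have := L_ge0.
by case: (lerP x L) => ?; case: (lerP y L) => ?; lra.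
Qed.

(** The list [s] is in the order of an arbitrary schedule and [c k] is its completion time in
    position [k]. Up to the number [m] of jobs not exceeding [L] only the totals compare; beyond it,
    prefix sums of loads compare position by position. *)
Lemma lower_sum_sorted_le (s s' : seq R) (c : nat -> R) :
  perm_eq s s' -> sorted <=%R s' -> {in s, forall x, 0 < x} ->
  (forall k, (k < size s)%N ->
     \sum_(x <- take k.+1 s) x + L + s`_k <= c k /\
     \sum_(x <- take k.+1 s) load L x <= c k) ->
  lower_sum L 0 0 s' <= \sum_(0 <= k < size s) c k.
Proof.
move=> ss' so spos hc; have szE := perm_size ss'.
rewrite lower_sumE -szE.
set m := find (fun x => L < x) s'.
have ms : (m <= size s)%N by rewrite szE find_size.
rewrite (big_cat_nat (leq0n m) ms) /= [leRHS](big_cat_nat (leq0n m) ms) /=.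
have takeS (t : seq R) (f : R -> R) k : (k < size t)%N ->
    \sum_(x <- take k.+1 t) f x = \sum_(x <- take k t) f x + f t`_k.
  by move=> kt; rewrite (take_nth 0) // -cats1 big_cat /= big_seq1.
have take_nat (t : seq R) k : (k <= size t)%N ->
    \sum_(x <- take k t) x = \sum_(0 <= i < k) t`_i.
  move=> kt; rewrite (big_nth 0) size_takel //.
  by apply: eq_big_nat => i /andP[_ ik]; rewrite nth_take.
apply: lerD; last first.
  apply: ler_sum_nat => k /andP[mk ks].
  have Lk : L < s'`_k.
    have m's : (m < size s')%N by rewrite -szE; apply: leq_ltn_trans ks.
    have Lm : L < s'`_m by apply: (nth_find 0 (a := fun x => L < x)); rewrite has_find.
    apply: lt_le_trans Lm _.
    by apply: (sorted_leq_nth le_trans le_refl) => //; rewrite ?inE -?szE.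
  rewrite (lt_geF Lk) add0r; apply: le_trans (proj2 (hc k ks)).
  have := @sum_take_sorted _ (map (load L) s) (map (load L) s') k.+1.
  rewrite -!map_take !big_map; apply; first exact: perm_map.
  by rewrite (homo_sorted load_homo).
pose T (t : seq R) k : R := \sum_(x <- take k t) x.
(* A single entry of [s] may be smaller than the entry of [s'] in its position. Its own length is
   therefore split off: summed over the first [m] positions it is again a prefix sum, while the
   terms in [T] compare one by one. *)
apply: (@le_trans _ _ (\sum_(0 <= k < m) (T s k + s`_k + s`_k + Num.max (T s k) L))).
  rewrite [leRHS](eq_big_nat _ _ (F2 := fun k => (s`_k + s`_k) + (T s k + Num.max (T s k) L)));
    last by move=> k _; ring.
  rewrite [leLHS](eq_big_nat _ _ (F2 := fun k => (s'`_k + s'`_k) + (T s' k + Num.max (T s' k) L))); last first.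
    move=> k /andP[_ km]; rewrite leNgt.
    have := before_find 0 km => /= ->.
    by rewrite /= add0r /T; ring.
  rewrite big_split [leRHS]big_split /=; apply: lerD.
    rewrite !big_split /= -!take_nat // -?szE //.
    by have := sum_take_sorted m ss' so; lra.
  apply: ler_sum_nat => k _.
  have := sum_take_sorted k ss' so; rewrite -!/(T _ _) => H.
  by apply: lerD => //; rewrite ge_max !le_max H lexx orbT.
apply: ler_sum_nat => k /andP[_ km].
have ks : (k < size s)%N by apply: leq_trans ms.
have [h1 h2] := hc k ks; move: h1 h2.
rewrite !takeS // -!/(T _ _).
have : \sum_(x <- take k s) (x + x) <= \sum_(x <- take k s) load L x.
  apply: ler_sum => x _; rewrite /load; have := L_ge0.
  by case: ifP => _; lra.
rewrite big_split /= -!/(T _ _) => h3 h1.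
have : s`_k + s`_k <= load L s`_k.
  by rewrite /load; have := L_ge0; case: ifP => _; lra.
by have [?|?] := lerP (T s k) L; lra.
Qed.

(** * Structure of an arbitrary feasible schedule *)

Variables (n : nat) (p S : 'I_n -> R).
Hypothesis p_gt0 : forall j, 0 < p j.
Hypothesis S_feasible : feasible p (fun=> L) p S.

Lemma task_apart t u : t != u ->
  task_end p (fun=> L) p S t <= task_start p (fun=> L) S u \/
  task_end p (fun=> L) p S u <= task_start p (fun=> L) S t.
Proof.
move=> tu; apply: disjoint_itv_apart; last by case: S_feasible => _; apply.
  by rewrite ltrDl; case: t.2.
by rewrite ltrDl; case: u.2.
Qed.

(** If [j] starts before [i] is complete, its first task lies in the delay of [i], and the second
    task of [i] lies in the delay of [j]. Hence both lengths are at most [L], and the starting order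
    is the order of completion. *)
Lemma separate_or_interleaved i j : i != j -> S i <= S j ->
  S i + p i + L + p i <= S j \/
  [/\ S i + p i <= S j, S i + p i <= S j + p j - p i,
      S j + p j <= S i + p i + L, p i <= L & p j <= L].
Proof.
move=> ij Sij.
have t1 (b c : bool) : (i, b) != (j, c) by apply: contraNneq ij => -[->].
have := task_apart (t1 false false); have := task_apart (t1 true false).
have := task_apart (t1 true true).
rewrite /task_end /task_start /= => h1 h2 h3.
have := p_gt0 i; have := p_gt0 j; have := L_ge0.
have {}h3 : S i + p i <= S j by case: h3; have := p_gt0 j; lra.
by case: h2 => ?; [left; lra | case: h1 => ?; [right; split; lra | lra]].
Qed.

(** The first tasks of the jobs in [A] are packed between time 0 and the end of the first task of
    [j], which is followed by the delay and the second task of [j]. *)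
Lemma completion_ge_length A j : uniq A -> {in A, forall i, S i <= S j} ->
  \sum_(i <- A) p i + L + p j <= completion p (fun=> L) p S j.
Proof.
move=> uA Aj.
have := @packing _ _ S (fun i => S i + p i) A 0 (S j + p j) uA.
rewrite (eq_bigr p) => [H|i _]; last by ring.
have Sj : 0 <= S j by case: S_feasible.
have := p_gt0 j => pj.
have Sj' : 0 <= S j + p j by lra.
have := H Sj' _ _; rewrite /completion => H'.
suff : \sum_(i <- A) p i <= S j + p j - 0 by lra.
apply: H' => [i iA|i k iA kA ik].
  have := p_gt0 i => pi; have Si : 0 <= S i by case: S_feasible.
  split => //; first lra.
  have [->|ij] := eqVneq i j; first by [].
  by have := L_ge0; case: (separate_or_interleaved ij (Aj i iA)); [| case]; lra.
have := @task_apart (i, false) (k, false); rewrite /task_end /task_start /=.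
by apply; apply: contraNneq ik => -[->].
Qed.

(* The delay of a job longer than [L] stays idle, so it is counted with the *)
(* first task. *)
Lemma completion_ge_load A j : uniq A -> {in A, forall i, S i <= S j} ->
  \sum_(i <- A) load L (p i) <= completion p (fun=> L) p S j.
Proof.
move=> uA Aj.
pose lo (t : 'I_n * bool) := task_start p (fun=> L) S t.
pose hi (t : 'I_n * bool) := task_end p (fun=> L) p S t +
  (if t.2 || (p t.1 <= L) then 0 else L).
pose s := [seq (i, b) | i <- A, b <- [:: false; true]].
have -> : \sum_(i <- A) load L (p i) = \sum_(t <- s) (hi t - lo t).
  rewrite /s big_allpairs_dep /=; apply: eq_bigr => i _.
  rewrite !big_cons big_nil /hi /lo /task_end /task_start /load /=.
  by case: ifP => _; ring.
have memA t : t \in s -> t.1 \in A.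
  by case/allpairsP => -[i b] /= [iA _ ->].
have Sj : 0 <= S j by case: S_feasible.
have pj := p_gt0 j; have L0 := L_ge0.
rewrite -[leRHS]subr0; apply: packing.
- by rewrite allpairs_uniq // => -[i b] [i' b'].
- by rewrite /completion; lra.
- move=> [i b] /memA /= iA; rewrite /lo /hi /task_end /task_start /completion /=.
  have pi := p_gt0 i; have Si : 0 <= S i by case: S_feasible.
  have : S i + p i + L + p i <= S j + p j + L + p j.
    have [->|ij] := eqVneq i j; first by [].
    by case: (separate_or_interleaved ij (Aj i iA)); [| case]; lra.
  by case: b => /=; case: (lerP (p i) L) => ? /=; split; lra.
move=> [i b] [k c] /memA /= iA /memA /= kA ikbc.
have := task_apart ikbc.
rewrite /lo /hi /task_end /task_start /=.
have pi := p_gt0 i; have pk := p_gt0 k.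
have [E|ik] := eqVneq i k.
  by subst k; move: ikbc; case: b; case: c => //=; rewrite ?eqxx //;
    case: (lerP (p i) L) => ? /=; lra.
(* Two separate jobs stay disjoint after the extension by the delay; two interleaved jobs are both
   at most [L] long, so nothing was extended. *)
have [Sik|/ltW Ski] := lerP (S i) (S k).
  case: (separate_or_interleaved ik Sik) => [h _|[h1 h2 h3 h4 h5]].
    by left; case: b {ikbc}; case: c; case: (lerP (p i) L) => ? /=; lra.
  by rewrite h4 h5 !orbT !addr0.
rewrite eq_sym in ik.
case: (separate_or_interleaved ik Ski) => [h _|[h1 h2 h3 h4 h5]].
  by right; case: b {ikbc}; case: c; case: (lerP (p k) L) => ? /=; lra.
by rewrite h4 h5 !orbT !addr0.
Qed.

Lemma sum_completion_ge s' : perm_eq [seq p j | j <- enum 'I_n] s' ->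
  sorted <=%R s' -> lower_sum L 0 0 s' <= sum_completion p (fun=> L) p S.
Proof.
move=> ps' so.
pose js := sort (fun i j => S i <= S j) (enum 'I_n).
have pjs : perm_eq js (enum 'I_n) by rewrite perm_sort.
have ujs : uniq js by rewrite (perm_uniq pjs) enum_uniq.
have -> : sum_completion p (fun=> L) p S =
    \sum_(j <- js) completion p (fun=> L) p S j.
  by rewrite (perm_big _ pjs) /= big_enum.
(* A nonempty list provides the default job [j0] for [nth]. *)
case E : js => [|j0 js0].
  rewrite big_nil; move: ps'; have : perm_eq [::] (enum 'I_n) by rewrite -E.
  by rewrite perm_sym => /perm_nilP -> /=; rewrite perm_sym => /perm_nilP ->.
rewrite -E (big_nth j0) -(size_map p js).
have pss : perm_eq (map p js) s' by apply: perm_trans ps'; apply: perm_map.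
apply: lower_sum_sorted_le pss so _ _ => [x /mapP[j _ ->] //|k].
rewrite size_map => kjs; rewrite -map_take !big_map (nth_map j0) //.
have sub : {in take k.+1 js, forall i, S i <= S (nth j0 js k)}.
  move=> i /(nthP j0)[l]; rewrite size_takel // ltnS => lk <-.
  rewrite nth_take ?ltnS //.
  apply: (sorted_leq_nth (leT := fun i j => S i <= S j)) => //.
  - by move=> x y z; apply: le_trans.
  - by apply: sort_sorted => x y; apply: le_total.
  - by rewrite inE (leq_ltn_trans lk).
split; first by apply: completion_ge_length => //; apply: take_uniq.
by apply: completion_ge_load => //; apply: take_uniq.
Qed.

End LowerBound.

(** * Output of the algorithm *)

Section Schedule.

Variables (R : realFieldType) (n : nat) (p : 'I_n -> R) (L : R).
Hypothesis p_gt0 : forall j, 0 < p j.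
Hypothesis L_ge0 : 0 <= L.

Lemma run_bind (A B : Type) (e : prog R A) (f : A -> prog R B) :
  run (bind e f) = run (f (run e)).
Proof. by elim: e => //=. Qed.

Let keyed (j : 'I_n) : R * job 'I_n R := (p j + p j, Job j (p j) (p j)).
Let shorter (i j : 'I_n) := p i <= p j.

Let shorter_trans : transitive shorter.
Proof. by move=> j i k; apply: le_trans. Qed.

Lemma run_insert i l : sorted shorter l ->
  exists l', [/\ run (insert (p i + p i) (Job i (p i) (p i)) (map keyed l)) = map keyed l',
                 perm_eq l' (i :: l) & sorted shorter l'].
Proof.
elim: l => [|j l IH] /= jl; first by exists [:: i].
have [ij|ji] := lerP (p i + p i) (p j + p j).
  exists [:: i, j & l]; split => //=; rewrite jl andbT /shorter.
  by lra.
have [l' [El' pl' sl']] := IH (path_sorted jl).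
exists (j :: l'); split.
- by rewrite run_bind El'.
- rewrite -(perm_cons j) in pl'; apply: perm_trans pl' _.
  by apply/permPl; apply: (perm_catCA [:: j] [:: i] l).
rewrite /= path_min_sorted // (perm_all _ pl') /= (order_path_min shorter_trans jl) andbT.
by rewrite /shorter; lra.
Qed.

Lemma run_sort_jobs l :
  exists l', [/\ run (sort_jobs [seq Job j (p j) (p j) | j <- l]) = map keyed l',
                 perm_eq l' l & sorted shorter l'].
Proof.
elim: l => [|i l [l' [El' pl' sl']]] /=; first by exists [::].
rewrite run_bind El' /=; have [l2 [-> p2 s2]] := run_insert i sl'.
by exists l2; split => //; apply: perm_trans p2 _; rewrite perm_cons.
Qed.

Definition slot_apart (s e : R) (q : placed 'I_n R) : bool :=
  ((e <= start1 q) || (end1 q <= s)) && ((e <= start2 q) || (end2 q <= s)).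

Definition compatible (q q' : placed 'I_n R) : bool :=
  slot_apart (start1 q) (end1 q) q' && slot_apart (start2 q) (end2 q) q'.

Lemma run_slot_free s e sched : run (slot_free s e sched) = all (slot_apart s e) sched.
Proof.
have run_apart x y x' y' : run (apart x y x' y') = (y <= x') || (y' <= x).
  by rewrite /=; case: ifP.
elim: sched => // q sched IH.
transitivity (run (let! c1 := apart s e (start1 q) (end1 q) in
  if c1 then
    let! c2 := apart s e (start2 q) (end2 q) in
    if c2 then slot_free s e sched else Ret false
  else Ret false)) => //.
rewrite run_bind run_apart [in RHS]/= {1}/slot_apart -andbA; case: (_ || _) => //.
by rewrite run_bind run_apart -IH; case: (_ || _).
Qed.

Lemma run_fits q sched : run (fits q sched) = all (compatible q) sched.
Proof.
rewrite /fits run_bind run_slot_free (all_predI (slot_apart _ _)).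
by case: ifP => //= _; rewrite run_slot_free.
Qed.

Definition first_at (j : 'I_n) (s : R) : placed 'I_n R :=
  Placed j s (s + p j) (s + p j + L) (s + p j + L + p j).

Definition second_at (j : 'I_n) (s : R) : placed 'I_n R :=
  Placed j (s - L - p j) (s - L) s (s + p j).

Lemma run_place_all_cons prev older j l :
  let sched := prev :: older in
  run (place_all L prev older (keyed j :: l)) =
    if all (compatible (first_at j (end1 prev))) sched
    then run (place_all L (first_at j (end1 prev)) sched l)
    else if all (compatible (second_at j (end2 prev))) sched
    then run (place_all L (second_at j (end2 prev)) sched l)
    else run (place_all L (first_at j (end2 prev)) sched l).
Proof.
move=> sched.
transitivity (run (
  let! q1 := place_first_at L (Job j (p j) (p j)) (end1 prev) in
  let! c1 := fits q1 sched in
  if c1 then place_all L q1 sched l else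
  let! q2 := place_second_at L (Job j (p j) (p j)) (end2 prev) in
  let! c2 := fits q2 sched in
  if c2 then place_all L q2 sched l else
  let! q3 := place_first_at L (Job j (p j) (p j)) (end2 prev) in
  place_all L q3 sched l)) => //.
rewrite run_bind [run (place_first_at _ _ _)]/= run_bind run_fits -/(first_at j _).
case: ifP => // _.
rewrite run_bind [run (place_second_at _ _ _)]/= run_bind run_fits -/(second_at j _).
by case: ifP.
Qed.

Definition well_placed (q : placed 'I_n R) : bool :=
  [&& 0 <= start1 q, end1 q == start1 q + p (placed_id q), start2 q == end1 q + L
    & end2 q == start2 q + p (placed_id q)].

(** Loop invariant. The last disjunction separates jobs of earlier blocks from those of the current
    one; it leaves the machine idle between [end1 prev] and [beta]. *)
Definition before (prev : placed 'I_n R) (beta : R) (q : placed 'I_n R) : bool :=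
  [&& well_placed q, end1 q <= end1 prev, end2 q <= end2 prev
    & (end2 q <= end1 prev) || (beta <= start2 q)].

(** Step (i) succeeds exactly when the new first task fits into the idle time before [beta]: lengths
    are non-decreasing, so the new second task then starts after [end2 prev]. Otherwise step (ii)
    fails too, and step (iii) opens a block behind everything placed. *)
Lemma run_place_all prev older beta l :
  let sched := prev :: older in
  all (before prev beta) sched -> has (fun q => start2 q == beta) sched ->
  end1 prev <= beta -> pairwise compatible sched ->
  path shorter (placed_id prev) l ->
  let out := run (place_all L prev older (map keyed l)) in
  [/\ all well_placed out, pairwise compatible out,
      perm_eq (map (@placed_id _ _) out) (map (@placed_id _ _) sched ++ l)
    & \sum_(q <- out) end2 q = \sum_(q <- sched) end2 q
        + greedy_sum L (end1 prev) beta (p (placed_id prev)) (map p l)].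
Proof.
have L0 := L_ge0.
elim: l prev older beta => [|j l IH] prev older beta sched bef head prev_beta comp pl.
  by rewrite /= -/sched cats0 addr0; split => //; apply: sub_all bef => q /and4P[].
have /andP[le_pj pl'] : (p (placed_id prev) <= p j) && path shorter j l := pl.
have pj := p_gt0 j; have pp := p_gt0 (placed_id prev).
have /andP[/and4P[/and4P[s0 /eqP e1 /eqP s2 /eqP e2] _ _ _] _] := bef.
rewrite [map keyed _]/= run_place_all_cons -/sched.
(* [h] plays the head of the current block: its second task starts at [beta] and obstructs what
   follows. *)
have [h [hall hbeta]] : exists h, (forall P, all P sched -> P h) /\ start2 h = beta.
  have /(has_nthP prev)[k ks /eqP hbeta] := head.
  by exists (nth prev sched k); split=> // P /(all_nthP prev); apply.
have hbef := hall _ bef.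
have ph := p_gt0 (placed_id h).
have /and4P[/and4P[h0 /eqP he1 /eqP hs2 /eqP he2] h1 h2 h3] := hbef.
have wf_first t : 0 <= t -> well_placed (first_at j t).
  by move=> t0; rewrite /well_placed /= t0 !eqxx.
have [fit|nofit] := lerP (end1 prev + p j) beta.
  have comp1 : all (compatible (first_at j (end1 prev))) sched.
    apply: sub_all bef => q /and4P[/and4P[q0 /eqP qe1 /eqP qs2 /eqP qe2] q1 q2 q3].
    have pq := p_gt0 (placed_id q).
    rewrite /compatible /slot_apart /=; apply/andP; split; apply/andP; split; apply/orP.
    - by right.
    - by case/orP: q3 => q3; [right|left]; lra.
    - by right; lra.
    - by right; lra.
  rewrite comp1.
  have [||||//|w1 c1 perm1 sum1] := IH (first_at j (end1 prev)) sched beta.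
  - rewrite /= {1}/before wf_first /= ?lexx ?fit ?orbT; last by lra.
    apply/andP; split; first by apply/orP; right; lra.
    rewrite -[_ && _]/(all (before (first_at j (end1 prev)) beta) sched).
    apply: sub_all bef => q /and4P[wq q1 q2 q3]; rewrite /before wq /=.
    by apply/and3P; split; [lra | lra | case/orP: q3 => q3; apply/orP; [left|right]; lra].
  - by apply/orP; right.
  - by [].
  - by apply/andP; split.
  split => //.
    apply: perm_trans perm1 _.
    exact: (permEl (perm_catCA [:: j] (map (@placed_id _ _) sched) l)).
  by rewrite sum1 big_cons greedy_sum_cons fit /=; ring.
have -> : all (compatible (first_at j (end1 prev))) sched = false.
  apply/negP => /hall; rewrite /compatible /slot_apart /= => /andP[/andP[_ /orP[?|?]] _]; lra.
(* The first task of [j] would end at [end1 prev] plus the length of [prev]. As [j] is at least as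
   long, it overlaps the first task of [prev], unless both lengths agree; then it is the interval
   rejected in step (i) and meets the second task of [h]. *)
have -> : all (compatible (second_at j (end2 prev))) sched = false.
  apply/negP => allc; have := hall _ allc; have /andP[] := allc.
  rewrite /compatible /slot_apart /= => /andP[/andP[+ _] _] _ /andP[/andP[_ +] _].
  by case/orP => ?; case/orP => ?; lra.
have [||||//|w1 c1 perm1 sum1] := IH (first_at j (end2 prev)) sched (end2 prev + p j + L).
- rewrite /= {1}/before wf_first /= ?lexx ?orbT; last by lra.
  apply/andP; split=> //.
  rewrite -[_ && _]/(all (before (first_at j (end2 prev)) _) sched).
  apply: sub_all bef => q /and4P[wq q1 q2 q3]; rewrite /before wq /=.
  have /and4P[q0 /eqP qe1 /eqP qs2 /eqP qe2] := wq; have pq := p_gt0 (placed_id q).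
  by apply/and3P; split; [lra | lra | apply/orP; left; lra].
- by rewrite /= eqxx.
- by rewrite /=; lra.
- apply/andP; split=> //.
  apply: sub_all bef => q /and4P[/and4P[q0 /eqP qe1 /eqP qs2 /eqP qe2] q1 q2 q3].
  have pq := p_gt0 (placed_id q).
  by rewrite /compatible /slot_apart /=; do 2!(apply/andP; split);
    apply/orP; right; lra.
split => //.
  apply: perm_trans perm1 _.
  exact: (permEl (perm_catCA [:: j] (map (@placed_id _ _) sched) l)).
rewrite sum1 big_cons greedy_sum_cons (lt_geF nofit) /=.
have -> : end2 prev = end1 prev + L + p (placed_id prev) by lra.
by ring.
Qed.


Lemma algorithm2_output :
  let out := run (algorithm2 L (jobs_of p p)) in
  [/\ all well_placed out, pairwise compatible out,
      perm_eq (map (@placed_id _ _) out) (enum 'I_n)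
    & exists2 l, perm_eq [seq p j | j <- enum 'I_n] l /\ sorted <=%R l &
      \sum_(q <- out) end2 q <= 3 / 2 * lower_sum L 0 0 l].
Proof.
have [l [El pl sl]] := run_sort_jobs (enum 'I_n).
have pml : perm_eq [seq p j | j <- enum 'I_n] (map p l).
  by rewrite perm_sym perm_map.
rewrite /algorithm2 /jobs_of run_bind El.
case: l pl sl pml {El} => [|j l] pl sl pml.
  split => //=; exists [::]; last by rewrite big_nil mulr0.
  by [].
have pj := p_gt0 j; have L0 := L_ge0.
rewrite [map keyed _]/= [run _]/=.
rewrite -/(first_at j 0).
have [||||//|w c perm sum] := @run_place_all (first_at j 0) [::] (p j + L) l.
- by rewrite /= andbT /before /well_placed /= !eqxx !lexx add0r lexx orbT.
- by rewrite /= add0r eqxx.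
- by rewrite /= add0r; lra.
- by [].
split => //; first exact: perm_trans perm pl.
exists (map p (j :: l)); first by split => //; rewrite sorted_map.
rewrite sum big_seq1 [end2 _]/= [end1 _]/= [placed_id _]/= !add0r.
by apply: greedy_sum_le; rewrite // path_map.
Qed.

End Schedule.

(** * Feasibility and the factor 3/2 *)

Section Approximation.

Variables (R : realFieldType) (n : nat) (p : 'I_n -> R) (L : R).
Hypothesis p_gt0 : forall j, 0 < p j.
Hypothesis L_ge0 : 0 <= L.

Lemma algorithm2_feasible : feasible p (fun=> L) p (algorithm2_schedule p p L).
Proof.
have [wf comp ids _] := algorithm2_output p_gt0 L_ge0.
set out := run _ in wf comp ids; set S := algorithm2_schedule p p L.
case: (posnP n) => [n0|n_gt0].
  have no (j : 'I_n) : False by case: j => m; rewrite n0.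
  by split=> [j|[j b]]; case: (no j).
pose q0 : placed 'I_n R := Placed (Ordinal n_gt0) 0 0 0 0.
pose k j := index j (map (@placed_id _ _) out).
have kout j : (k j < size out)%N.
  by rewrite -(size_map (@placed_id _ _)) index_mem (perm_mem ids) mem_enum.
have idk j : placed_id (nth q0 out (k j)) = j.
  by rewrite -(nth_map _ j) // nth_index // (perm_mem ids) mem_enum.
have wfk j : [/\ 0 <= S j, start1 (nth q0 out (k j)) = S j,
    end1 (nth q0 out (k j)) = S j + p j,
    start2 (nth q0 out (k j)) = S j + p j + L
    & end2 (nth q0 out (k j)) = S j + p j + L + p j].
  have SE : start1 (nth q0 out (k j)) = S j by apply: esym; apply: (nth_map q0 0 (fun q => start1 q) (kout j)).
  have /(all_nthP q0) /(_ (k j) (kout j)) := wf.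
  rewrite /well_placed idk -SE => /and4P[s0 /eqP -> /eqP -> /eqP ->].
  by split.
split=> [j|t u tu x]; first by case: (wfk j).
have sep i j : (k i < k j)%N -> forall b c,
    task_end p (fun=> L) p S (i, b) <= task_start p (fun=> L) S (j, c) \/
    task_end p (fun=> L) p S (j, c) <= task_start p (fun=> L) S (i, b).
  move=> kij; have /(pairwiseP q0) /(_ (k i) (k j)) := comp.
  rewrite !inE !kout => /(_ isT isT kij).
  rewrite /compatible /slot_apart.
  have [_ -> -> -> ->] := wfk i; have [_ -> -> -> ->] := wfk j.
  move=> /andP[/andP[/orP h1 /orP h2] /andP[/orP h3 /orP h4]].
  by case; case; rewrite /task_end /task_start /=.
have sep' : task_end p (fun=> L) p S t <= task_start p (fun=> L) S u \/
    task_end p (fun=> L) p S u <= task_start p (fun=> L) S t.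
  case: t u tu => [i b] [j c] tu.
  have [kij|kji|kij] := ltngtP (k i) (k j); first exact: sep.
    by case: (sep _ _ kji c b); [right|left].
  have ij : i = j by rewrite -(idk i) kij idk.
  subst j; have pi := p_gt0 i; have L0 := L_ge0.
  rewrite /task_end /task_start.
  by case: b tu; case: c; rewrite ?eqxx //= => _; [right|left]; lra.
rewrite !in_itv /=; apply: contraTN => /andP[x1 x2]; rewrite negb_and -!leNgt.
by case: sep' => h; apply/orP; [right|left]; lra.
Qed.

Lemma algorithm2_sum_completion S : feasible p (fun=> L) p S ->
  sum_completion p (fun=> L) p (algorithm2_schedule p p L)
    <= 3%:R / 2%:R * sum_completion p (fun=> L) p S.
Proof.
move=> feas.
have [wf comp ids [l [pl sl] sumle]] := algorithm2_output p_gt0 L_ge0.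
have lb := sum_completion_ge L_ge0 p_gt0 feas pl sl.
suff -> : sum_completion p (fun=> L) p (algorithm2_schedule p p L) =
    \sum_(q <- run (algorithm2 L (jobs_of p p))) end2 q by lra.
rewrite /sum_completion /completion /algorithm2_schedule /=.
set out := run _ in wf comp ids *.
have uids : uniq (map (@placed_id _ _) out) by rewrite (perm_uniq ids) enum_uniq.
(* Each job occurs once in the output, so the sum over jobs becomes a sum over output positions,
   where [index] recovers the position. *)
rewrite -big_enum -(perm_big _ ids) /= big_map.
case: out wf uids {comp ids} => [|q0 out'] wf uids; first by rewrite !big_nil.
rewrite !(big_nth q0); apply: eq_big_nat => k /andP[_ ks].
have /(all_nthP q0) /(_ k ks) := wf.
rewrite -(nth_map _ (placed_id q0) (@placed_id _ _)) // index_uniq ?size_map //.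
rewrite (nth_map q0) // (nth_map q0) //.
by rewrite /well_placed => /and4P[_ /eqP -> /eqP -> /eqP ->].
Qed.

End Approximation.

(** * Running time *)

Lemma ltn_bitlen m : (m < 2 ^ bitlen m)%N.
Proof. exact: trunc_log_ltn. Qed.

Lemma bitlen_leq m k : (m <= 2 ^ k)%N -> (bitlen m <= k.+1)%N.
Proof. by move=> mk; rewrite ltnS -[leqRHS](@trunc_expnK 2) // leq_trunc_log. Qed.

Section Cost.

Variables (N D : nat).
Hypothesis D_gt0 : (0 < D)%N.
Hypothesis D_le : (D <= 2 ^ N)%N.

(** Sizes are measured over the fixed denominator [D], because then an addition or subtraction costs
    one bit; the sizes of reduced fractions may add up. *)
Definition small (m : nat) (x : rat) : Prop :=
  exists2 z : int, x * D%:R = z%:~R & (`|z| <= 2 ^ m)%N.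

Lemma small_mono m m' x : (m <= m')%N -> small m x -> small m' x.
Proof.
by move=> mm' [z zE zm]; exists z => //; apply: leq_trans zm _; rewrite leq_exp2l.
Qed.

Lemma small0 m : small m 0.
Proof. by exists 0 => //; rewrite mul0r. Qed.

Lemma smallD m x y : small m x -> small m y -> small m.+1 (x + y).
Proof.
move=> [z zE zm] [t tE tm]; exists (z + t); first by rewrite mulrDl zE tE rmorphD.
by rewrite expnS; lia.
Qed.

Lemma smallB m x y : small m x -> small m y -> small m.+1 (x - y).
Proof.
move=> [z zE zm] [t tE tm]; exists (z - t); first by rewrite mulrBl zE tE rmorphB.
by rewrite expnS; lia.
Qed.

(** The reduced denominator divides [D], and the reduced numerator is no larger than the numerator
    over [D]. *)
Lemma rat_size_small m x : small m x -> (rat_size x <= m + N + 3)%N.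
Proof.
move=> [z zE zm].
have E : numq x * D%:Z = z * denq x.
  by apply/eqP; rewrite -(eqr_int rat) !intrM -zE numqE mulrAC.
have dD : (`|denq x| %| D)%N.
  have := coprime_num_den x; rewrite coprime_sym => /Gauss_dvdr <-.
  by move/(congr1 absz): E; rewrite !abszM /= => ->; rewrite dvdn_mull.
have dleD := dvdn_leq D_gt0 dD.
have nz : (`|numq x| <= `|z|)%N.
  move/(congr1 absz): E; rewrite !abszM /= => E.
  by rewrite -(leq_pmul2r D_gt0) E leq_mul2l dleD orbT.
rewrite /rat_size; have := bitlen_leq (leq_trans nz zm).
by have := bitlen_leq (leq_trans dleD D_le); lia.
Qed.

Variable M : nat.

(** A uniform price for every elementary step while all numbers are [small M]; the successor makes
    it visibly positive, so that it also covers [Tick] and [Zero]. *)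
Definition unit_price : nat := ((2 * (M + N + 3)) ^ 2).+1.

(** A Hoare-style judgement whose postcondition carries the size bounds that the cost of later steps
    depends on; [takes_bind] is its sequencing rule. *)
Definition takes (A : Type) (e : prog rat A) (k : nat) (P : A -> Prop) : Prop :=
  (cost bit_cost e <= k * unit_price)%N /\ P (run e).

Lemma takes_bind (A B : Type) (e : prog rat A) (f : A -> prog rat B) k k' P Q :
  takes e k P -> (forall x, P x -> takes (f x) k' Q) -> takes (bind e f) (k + k') Q.
Proof.
move=> [ce Pe] /(_ _ Pe) [cf Qf]; split; last first.
  by suff -> : run (bind e f) = run (f (run e)) by []; elim: e {ce Pe cf Qf} => //=.
suff -> : cost bit_cost (bind e f) = (cost bit_cost e + cost bit_cost (f (run e)))%N.
  by rewrite mulnDl leq_add.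
by elim: e {ce Pe cf Qf} => //= *; rewrite -addnA; congr addn.
Qed.

Lemma takes_ret (A : Type) (x : A) (P : A -> Prop) k : P x -> takes (Ret x) k P.
Proof. by []. Qed.

Lemma takes_tick (A : Type) (e : prog rat A) k P : takes e k P -> takes (Tick e) k.+1 P.
Proof. by move=> [ce Pe]; split=> //=; rewrite mulSn leq_add. Qed.

Lemma takes_weaken (A : Type) (e : prog rat A) k k' (P Q : A -> Prop) :
  (k <= k')%N -> (forall x, P x -> Q x) -> takes e k P -> takes e k' Q.
Proof.
move=> kk' PQ [ce Pe]; split; last exact: PQ.
by apply: leq_trans ce _; rewrite leq_mul2r kk' orbT.
Qed.

Lemma bit_cost_le x y : small M x -> small M y -> (bit_cost x y <= unit_price)%N.
Proof.
move=> /rat_size_small sx /rat_size_small sy; apply: leqW.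
by rewrite leq_exp2r // mul2n -addnn leq_add.
Qed.

Lemma takes_add m x y : (m <= M)%N -> small m x -> small m y ->
  takes (Defs.add x y) 1 (small m.+1).
Proof.
move=> mM sx sy; split; last exact: smallD.
by rewrite /= addn0 mul1n bit_cost_le //; apply: small_mono mM _.
Qed.

Lemma takes_sub m x y : (m <= M)%N -> small m x -> small m y ->
  takes (Defs.sub x y) 1 (small m.+1).
Proof.
move=> mM sx sy; split; last exact: smallB.
by rewrite /= addn0 mul1n bit_cost_le //; apply: small_mono mM _.
Qed.

Lemma takes_leq x y : small M x -> small M y -> takes (leq_num x y) 1 xpredT.
Proof. by move=> sx sy; split; rewrite //= addn0 mul1n bit_cost_le. Qed.

Variable I : Type.

Definition small_job m (j : job I rat) : Prop := small m (len1 j) /\ small m (len2 j).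

Definition small_placed m (q : placed I rat) : Prop :=
  [/\ small m (start1 q), small m (end1 q), small m (start2 q) & small m (end2 q)].

Lemma small_placed_mono m m' q : (m <= m')%N -> small_placed m q -> small_placed m' q.
Proof. by move=> mm' [*]; split; apply: small_mono mm' _. Qed.

Fixpoint Forall (A : Type) (P : A -> Prop) (l : seq A) : Prop :=
  if l is x :: l' then P x /\ Forall P l' else True.

Lemma Forall_impl (A : Type) (P Q : A -> Prop) l :
  (forall x, P x -> Q x) -> Forall P l -> Forall Q l.
Proof. by move=> PQ; elim: l => //= x l IH [/PQ ? /IH]. Qed.

Definition small_keyed (kj : rat * job I rat) : Prop :=
  small M kj.1 /\ small_job N kj.2.

Lemma takes_insert k j l : small_keyed (k, j) -> Forall small_keyed l ->
  takes (insert k j l) (2 * size l + 1)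
    (fun r => Forall small_keyed r /\ size r = (size l).+1).
Proof.
move=> kj; elim: l => [|[k' j'] l IH] /= sl; first by apply: takes_tick; apply: takes_ret.
have [sk sl'] := sl.
apply: (@takes_weaken _ _ (1 + (2 * size l + 1)).+1 _ _ _ _ (fun r H => H)); first by lia.
apply: takes_tick; apply: (takes_bind (takes_leq kj.1 sk.1)) => -[] _.
  by apply: takes_ret.
rewrite -[(2 * size l + 1)%N]addn0; apply: takes_bind (IH sl') _ => r [sr szr].
by apply: takes_ret; rewrite /= szr.
Qed.

Lemma takes_sort l : (N < M)%N -> Forall (small_job N) l ->
  takes (sort_jobs l) ((size l).+1 ^ 2)
    (fun r => Forall small_keyed r /\ size r = size l).
Proof.
move=> NM; elim: l => [|j l IH] /= sl; first by apply: takes_tick; apply: takes_ret.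
have [sj sl'] := sl.
apply: (@takes_weaken _ _ ((size l).+1 ^ 2 + (1 + (2 * size l + 1))).+1 _ _ _ _
  (fun r H => H)); first by rewrite !expnS expn0; nia.
apply: takes_tick; apply: takes_bind (IH sl') _ => r [sr szr].
apply: takes_bind (takes_add (ltnW NM) sj.1 sj.2) _ => k sk.
rewrite -szr; apply: takes_insert => //; split=> //.
exact: small_mono sk.
Qed.

Variable L : rat.
Hypothesis small_L : small N L.

Lemma takes_first m j s : (N <= m)%N -> (m + 3 <= M)%N -> small_job N j -> small m s ->
  takes (place_first_at L j s) 3 (small_placed (m + 3)).
Proof.
move=> Nm mM [s1 s2] ss.
have H x : small N x -> forall i, small (m + i) x.
  by move=> sx i; apply: small_mono sx; lia.
rewrite -[3%N]/(1 + (1 + (1 + 0)))%N.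
apply: takes_bind (@takes_add m _ _ _ _ _) _ => //; [lia | exact: small_mono s1 |].
move=> e se; apply: takes_bind (@takes_add m.+1 _ _ _ _ _) _ => //.
- by lia.
- by apply: small_mono small_L; lia.
move=> s' ss'; apply: takes_bind (@takes_add m.+2 _ _ _ _ _) _ => //.
- by lia.
- by apply: small_mono s2; lia.
move=> e' se'; apply: takes_ret; split => /=.
- by apply: small_mono ss; lia.
- by apply: small_mono se; lia.
- by apply: small_mono ss'; lia.
- by apply: small_mono se'; lia.
Qed.

Lemma takes_second m j s : (N <= m)%N -> (m + 3 <= M)%N -> small_job N j -> small m s ->
  takes (place_second_at L j s) 3 (small_placed (m + 3)).
Proof.
move=> Nm mM [s1 s2] ss.
rewrite -[3%N]/(1 + (1 + (1 + 0)))%N.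
apply: takes_bind (@takes_sub m _ _ _ _ _) _ => //; [lia | exact: small_mono small_L |].
move=> e se; apply: takes_bind (@takes_sub m.+1 _ _ _ _ _) _ => //.
- by lia.
- by apply: small_mono s1; lia.
move=> s' ss'; apply: takes_bind (@takes_add m _ _ _ _ _) _ => //.
- by lia.
- exact: small_mono s2.
move=> e' se'; apply: takes_ret; split => /=.
- by apply: small_mono ss'; lia.
- by apply: small_mono se; lia.
- by apply: small_mono ss; lia.
- by apply: small_mono se'; lia.
Qed.

Lemma takes_apart s e s' e' : small M s -> small M e -> small M s' -> small M e' ->
  takes (apart s e s' e') 2 xpredT.
Proof.
move=> *; rewrite -[2%N]/(1 + 1)%N; apply: takes_bind (takes_leq _ _) _ => //.
by case=> _; [apply: takes_ret | apply: takes_leq].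
Qed.

Lemma takes_slot_free s e (sched : seq (placed I rat)) : small M s -> small M e ->
  Forall (small_placed M) sched ->
  takes (slot_free s e sched) (5 * size sched + 1) xpredT.
Proof.
move=> ss se; elim: sched => [|q sched IH]; first by move=> _; apply: takes_tick; apply: takes_ret.
move=> [[q1 q2 q3 q4] sq].
apply: (@takes_weaken _ _ (2 + (2 + (5 * size sched + 1))).+1 _ _ _ _ (fun r H => H)).
  by rewrite /=; lia.
apply: takes_tick; apply: takes_bind (takes_apart ss se q1 q2) _ => -[] _; last exact: takes_ret.
apply: takes_bind (takes_apart ss se q3 q4) _ => -[] _; last exact: takes_ret.
exact: IH.
Qed.

Lemma takes_fits q (sched : seq (placed I rat)) :
  small_placed M q -> Forall (small_placed M) sched ->
  takes (fits q sched) (10 * size sched + 2) xpredT.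
Proof.
move=> [q1 q2 q3 q4] sq.
apply: (@takes_weaken _ _ ((5 * size sched + 1) + (5 * size sched + 1)) _ _ _ _
  (fun r H => H)); first by lia.
apply: takes_bind (takes_slot_free q1 q2 sq) _ => -[] _; last exact: takes_ret.
exact: takes_slot_free.
Qed.

(** The size bound [m] grows by 3 per job, hence the budget [m + 3 * size l]. One job needs a tick,
    at most three placements of 3 steps and two tests of at most [10 * n + 2] steps, in total
    [20 * n + 14]. *)
Lemma takes_place_all n m prev older l (sched := prev :: older) :
  (N <= m)%N -> (m + 3 * size l <= M)%N -> (size sched + size l <= n)%N ->
  Forall (small_placed m) sched -> Forall small_keyed l ->
  takes (place_all L prev older l) (size l * (20 * n + 14) + 1) (fun=> True).
Proof.
elim: l m prev older @sched => [|[k j] l IH] m prev older sched Nm mM szn ssched sl.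
  by apply: takes_tick; apply: takes_ret.
have [[_ /= sj] sl'] := sl.
have [[p1 p2 p3 p4] _] := ssched.
rewrite /= in mM szn.
have sM : Forall (small_placed M) sched.
  by apply: Forall_impl ssched => q; apply: small_placed_mono; lia.
pose B := (size l * (20 * n + 14) + 1)%N; pose F := (10 * size sched + 2)%N.
apply: (@takes_weaken _ _ (3 + (F + (3 + (F + (3 + B))))).+1 _ _ _ _ (fun r H => H)).
  by rewrite /B /F /=; nia.
have next q : small_placed (m + 3) q -> takes (place_all L q sched l) B (fun=> True).
  move=> sq; apply: (IH (m + 3)%N); rewrite /= ?sq //; try lia.
  by split=> //; apply: Forall_impl ssched => q'; apply: small_placed_mono; lia.
have fit q : small_placed (m + 3) q -> takes (fits q sched) F xpredT.
  by move=> sq; apply: takes_fits => //; apply: small_placed_mono sq; lia.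
have m3 : (m + 3 <= M)%N by lia.
suff : takes (let! q1 := place_first_at L j (end1 prev) in
  let! c1 := fits q1 sched in
  if c1 then place_all L q1 sched l else
  let! q2 := place_second_at L j (end2 prev) in
  let! c2 := fits q2 sched in
  if c2 then place_all L q2 sched l else
  let! q3 := place_first_at L j (end2 prev) in
  place_all L q3 sched l) (3 + (F + (3 + (F + (3 + B))))) (fun=> True).
  by move/takes_tick.
apply: (takes_bind (takes_first Nm m3 sj p2)) => q1 sq1.
apply: takes_bind (fit _ sq1) _ => -[] _.
  by apply: takes_weaken (next _ sq1) => //; rewrite /B; lia.
apply: takes_bind (takes_second Nm m3 sj p4) _ => q2 sq2.
apply: takes_bind (fit _ sq2) _ => -[] _.
  by apply: takes_weaken (next _ sq2) => //; rewrite /B; lia.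
by apply: takes_bind (takes_first Nm m3 sj p4) _ => q3; apply: next.
Qed.

Lemma takes_algorithm2 jobs : (N + 3 + 3 * size jobs <= M)%N ->
  Forall (small_job N) jobs ->
  takes (algorithm2 L jobs) (21 * (size jobs).+1 ^ 2) (fun=> True).
Proof.
move=> hM sj; set n := size jobs in hM *.
apply: (@takes_weaken _ _ (n.+1 ^ 2 + (20 * n ^ 2 + 14 * n + 5)) _ _ _ _ (fun r H => H)).
  by rewrite !expnS !expn0; nia.
apply: takes_bind (takes_sort _ sj) _; first by lia.
case=> [|[k j] l] [sl szl]; first exact: takes_ret.
rewrite /= -/n in szl; have [[_ /= sj1] sl'] := sl.
apply: (@takes_weaken _ _ (1 + (3 + (size l * (20 * n + 14) + 1))) _ _ _ _ (fun r H => H)).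
  by rewrite !expnS !expn0; nia.
have Z : takes (Zero Ret : prog rat rat) 1 (small N) by split=> //; exact: small0.
rewrite -[X in takes X]/(let! z := Zero Ret in
  let! q := place_first_at L j z in place_all L q [::] l).
apply: (takes_bind Z) => z sz.
have h3 : (N + 3 <= M)%N by lia.
apply: (takes_bind (takes_first (leqnn N) h3 sj1 sz)) => q sq.
by apply: (@takes_place_all n (N + 3)); rewrite //=; lia.
Qed.

End Cost.

(** * Input sizes and the polynomial bound *)

Lemma small_input (s : seq rat) x : x \in s ->
  small (\prod_(y <- s) `|denq y|)%N (\sum_(y <- s) rat_size y) x.
Proof.
move=> /perm_to_rem ps; rewrite (perm_big _ ps) [X in small _ X _](perm_big _ ps) /=.
rewrite !big_cons; set r := rem x s.
(* Over the product of all denominators, the numerator of [x] is multiplied by the denominators of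
   the other inputs, and each factor is bounded by a separate summand of the total size. *)
exists (numq x * (\prod_(y <- r) `|denq y|)%N%:Z).
  rewrite natrM mulrA -[`|denq x|%N%:R]/(`|denq x|%N%:Z%:~R) absz_denq.
  by rewrite -numqE rmorphM.
rewrite abszM expnD leq_mul //=.
  apply: ltnW; apply: leq_trans (ltn_bitlen _) _; rewrite leq_exp2l // /rat_size.
  by lia.
elim: r => [|y r IH]; first by rewrite !big_nil.
rewrite !big_cons expnD leq_mul //.
apply: ltnW; apply: leq_trans (ltn_bitlen _) _; rewrite leq_exp2l // /rat_size.
by lia.
Qed.

Lemma prod_denq_bounds (s : seq rat) :
  (0 < \prod_(y <- s) `|denq y| <= 2 ^ \sum_(y <- s) rat_size y)%N.
Proof.
elim: s => [|y s /andP[pos le]]; first by rewrite !big_nil.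
rewrite !big_cons muln_gt0 absz_gt0 denq_eq0 pos expnD leq_mul //=.
apply: ltnW; apply: leq_trans (ltn_bitlen _) _; rewrite leq_exp2l // /rat_size.
by lia.
Qed.

Lemma algorithm2_polynomial : exists c k : nat,
  forall (n : nat) (a b : 'I_n -> rat) (L : rat),
    (cost bit_cost (algorithm2 L (jobs_of a b))
       <= c * instance_size a b L ^ k + c)%N.
Proof.
(* [c] is kept abstract: as a unary numeral it would be huge. *)
have [c cE] : exists c, (c = 21 * 14 ^ 2 * 16)%N by eexists.
exists c, 4 => n a b L.
set N := instance_size a b L.
pose s := L :: [seq a j | j <- enum 'I_n] ++ [seq b j | j <- enum 'I_n].
have NE : N = (\sum_(y <- s) rat_size y)%N.
  by rewrite big_cons big_cat 2!big_map !big_enum /N /instance_size big_split addnC.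
have /andP[D_gt0 D_le] := prod_denq_bounds s.
have sm x : x \in s -> small (\prod_(y <- s) `|denq y|)%N N x.
  by rewrite NE; apply: small_input.
have ina j : a j \in [seq a j | j <- enum 'I_n] by rewrite map_f // mem_enum.
have inb j : b j \in [seq b j | j <- enum 'I_n] by rewrite map_f // mem_enum.
have szj : size (jobs_of a b) = n by rewrite size_map size_enum_ord.
have nN : (n <= N)%N.
  rewrite /N /instance_size -{1}(card_ord n) -sum1_card.
  by apply: leq_trans (leq_addr _ _); apply: leq_sum => j _; rewrite /rat_size; lia.
rewrite -NE in D_le.
have [] := @takes_algorithm2 N _ D_gt0 D_le (N + 3 + 3 * n) _ L _ (jobs_of a b).
- by apply: sm; rewrite mem_head.
- by rewrite szj.
- rewrite /jobs_of; elim: (enum 'I_n) => //= j l IH; split=> //.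
  by split; apply: sm; rewrite inE mem_cat ?ina ?inb !orbT.
rewrite szj => le _; apply: leq_trans le _.
(* With [n <= N], both the number of steps and the price of a step are quadratic in [N], whence the
   exponent 4. *)
have price : (unit_price N (N + 3 + 3 * n) <= 14 ^ 2 * N.+1 ^ 2)%N.
  rewrite /unit_price -expnMn.
  have : (2 * (N + 3 + 3 * n + N + 3) < 14 * N.+1)%N by lia.
  move: (2 * _)%N (14 * _)%N => u v uv.
  by rewrite -[(_ ^ 2).+1]addn1; rewrite !expnS !expn0; nia.
have pow : (N.+1 ^ 4 <= 16 * N ^ 4 + 16)%N.
  case: (posnP N) => [->|N0]; first by [].
  apply: leq_trans (leq_addr _ _); rewrite -[16%N]/(2 ^ 4)%N -expnMn leq_exp2r //.
  by lia.
have -> : (c * N ^ 4 + c = 21 * 14 ^ 2 * (16 * N ^ 4 + 16))%N by rewrite cE; ring.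
apply: leq_trans (_ : (21 * 14 ^ 2 * N.+1 ^ 4 <= _)%N); last by rewrite leq_mul2l pow orbT.
rewrite -[4%N]/(2 + 2)%N expnD.
have -> : (21 * 14 ^ 2 * (N.+1 ^ 2 * N.+1 ^ 2) =
  (21 * N.+1 ^ 2) * (14 ^ 2 * N.+1 ^ 2))%N by ring.
by apply: leq_mul price; rewrite leq_mul2l leq_exp2r.
Qed.

Theorem theorem8 :
  (exists c k : nat,
     forall (n : nat) (a b : 'I_n -> rat) (L : rat),
       (forall j, 0 < a j) -> (forall j, 0 < b j) -> 0 <= L ->
       (cost bit_cost (algorithm2 L (jobs_of a b))
          <= c * instance_size a b L ^ k + c)%N) /\
  (forall (R : realFieldType) (n : nat) (p : 'I_n -> R) (L : R),
     (forall j, 0 < p j) -> 0 <= L ->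
     feasible p (fun=> L) p (algorithm2_schedule p p L) /\
     (forall S : 'I_n -> R, feasible p (fun=> L) p S ->
        sum_completion p (fun=> L) p (algorithm2_schedule p p L)
          <= 3%:R / 2%:R * sum_completion p (fun=> L) p S)).
Proof.
split; last first.
  move=> R n p L p_gt0 L_ge0; split; first exact: algorithm2_feasible.
  by move=> S; apply: algorithm2_sum_completion.
have [c [k ck]] := algorithm2_polynomial.
by exists c, k => n a b L _ _ _; apply: ck.
Qed.
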